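(* Let $A\subseteq\omega$ be an infinite c.e. set, let $\theta$ be a quasi-Gödel numbering of $\mathcal S^{(1)}_A$ and let $\varphi$ be a Gödel numbering of $\mathcal P^{(1)}$. Put $W^A_i=\mathrm{range}(\theta_i)$ and $W_i=\mathrm{dom}(\varphi_i)$ for $i\in\omega$. Then the numberings $W^A$ and $W$ of the c.e. subsets of $\omega$ are computably isomorphic, i.e. there is a computable bijection $g:\omega\to\omega$ with $W^A_i=W_{g(i)}$ for all $i\in\omega$.
   Context: $\omega$ is the set of natural numbers; $\mathcal P^{(n)}$ and $\mathcal R^{(n)}$ are the sets of $n$-ary partial, respectively total, computable functions on $\omega$. $\langle\cdot,\cdot\rangle:\omega^2\to\omega$ is a computable bijection with $\langle x,y\rangle\ge x,y$. $\mathrm{Anf}^{(1)}_A$ is the set of partial functions from $\omega$ to $\omega$ whose domain is either empty or equal to $\{0,\dots,a-1\}$ for some $a\in A$, and $\mathcal S^{(1)}_A=\mathcal R^{(1)}\cup\mathrm{Anf}^{(1)}_A$. The extended graph of a unary partial function $q$ is $\{\langle y,0\rangle:y\in\omega\}\cup\{\langle x,q(x)+1\rangle:x\in\mathrm{dom}(q)\}$; that of a binary partial function $q$ is $\{\langle\langle y,y'\rangle,0\rangle:y,y'\in\omega\}\cup\{\langle\langle x,x'\rangle,q(x,x')+1\rangle:(x,x')\in\mathrm{dom}(q)\}$. A numbering of a set $X$ is a surjection $\omega\to X$. A numbering $\theta$ of $\mathcal S^{(1)}_A$ is a quasi-Gödel numbering if: (QGN I) the extended graph of $(i,x)\mapsto\theta_i(x)$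 is the range of a function in $\mathcal R^{(1)}$; and (QGN II) for every $k\in\mathcal R^{(2)}$ there is $v\in\mathcal R^{(1)}$ such that for all $i\in\omega$, $r\in\mathcal S^{(1)}_A$: if $\{k(i,t):t\in\omega\}$ is the extended graph of $r$, then $r=\theta_{v(i)}$. A Gödel numbering of $\mathcal P^{(1)}$ is a numbering $\varphi$ with partial computable universal function $(i,x)\mapsto\varphi_i(x)$ such that for every $g\in\mathcal P^{(2)}$ there is $s\in\mathcal R^{(1)}$ with $\varphi_{s(i)}(x)=g(i,x)$ for all $i,x$. *)

(* Defs.v *)
From mathcomp Require Import all_boot.
From mathcomp Require Import boolp classical_sets functions cardinality.

Set Implicit Arguments.
Unset Strict Implicit.
Unset Printing Implicit Defensive.

Local Open Scope classical_set_scope.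

(* Kleene's mu-recursive functions; [recfun n] is the type of programs for
   n-ary partial functions. *)
Inductive recfun : nat -> Type :=
| Zero n : recfun n
| Succ : recfun 1
| Proj n (i : 'I_n) : recfun n
| Comp m n (f : recfun m) (g : 'I_m -> recfun n) : recfun n
| Prec n (f : recfun n) (g : recfun n.+2) : recfun n.+1
| Mu n (f : recfun n.+1) : recfun n.

(* The recursion variable comes first: h(0, v) = F v and
   h(k + 1, v) = G (k, h(k, v), v). *)
Fixpoint prec_rel n (F : n.-tuple nat -> nat -> Prop)
    (G : n.+2.-tuple nat -> nat -> Prop) (v : n.-tuple nat) (k y : nat) : Prop :=
  if k is k'.+1 then
    exists2 z, prec_rel F G v k' z & G [tuple of k' :: z :: v] y
  else F v y.

(* [eval f v y]: the computation of f on v terminates with value y.  In the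
   last case y is the least zero, and f is defined at all smaller arguments. *)
Fixpoint eval n (f : recfun n) : n.-tuple nat -> nat -> Prop :=
  match f with
  | Zero _ => fun _ y => y = 0
  | Succ => fun v y => y = (thead v).+1
  | Proj _ i => fun v y => y = tnth v i
  | Comp m _ f g => fun v y =>
      exists2 w : m.-tuple nat,
        forall i, eval (g i) v (tnth w i) & eval f w y
  | Prec _ f g => fun v y =>
      prec_rel (eval f) (eval g) [tuple of behead v] (thead v) y
  | Mu _ f => fun v y =>
      eval f [tuple of y :: v] 0 /\
      forall k, k < y -> exists z, eval f [tuple of k :: v] z.+1
  end.

(* A partial function on the natural numbers is a [nat -> option nat], with
   [None] for "undefined". *)
Definition pcomputable1 : set (nat -> option nat) :=
  [set q | exists f : recfun 1,
     forall x y, eval f [tuple x] y <-> q x = Some y].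

Definition pcomputable2 : set (nat -> nat -> option nat) :=
  [set q | exists f : recfun 2,
     forall x x' y, eval f [tuple x; x'] y <-> q x x' = Some y].

Definition computable1 : set (nat -> nat) :=
  [set h | pcomputable1 (fun x => Some (h x))].

Definition computable2 : set (nat -> nat -> nat) :=
  [set h | pcomputable2 (fun x x' => Some (h x x'))].

Definition pdom (q : nat -> option nat) : set nat :=
  [set x | exists y, q x = Some y].

Definition prange (q : nat -> option nat) : set nat :=
  [set y | exists x, q x = Some y].

Definition ce : set (set nat) := [set pdom q | q in pcomputable1].

Definition computable_pairing (pair : nat -> nat -> nat) : Prop :=
  [/\ computable2 pair,
      bijective (fun xy : nat * nat => pair xy.1 xy.2)
    & forall x y, x <= pair x y /\ y <= pair x y].

Definition extended_graph1 (pair : nat -> nat -> nat)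
    (q : nat -> option nat) : set nat :=
  [set pair y 0 | y in [set: nat]] `|`
  [set z | exists x y, q x = Some y /\ z = pair x y.+1].

Definition extended_graph2 (pair : nat -> nat -> nat)
    (q : nat -> nat -> option nat) : set nat :=
  [set z | exists y y', z = pair (pair y y') 0] `|`
  [set z | exists x x' y, q x x' = Some y /\ z = pair (pair x x') y.+1].

(* [`I_a] is the set of the naturals smaller than a. *)
Definition Anf1 (A : set nat) : set (nat -> option nat) :=
  [set q | pdom q = set0 \/ exists2 a, A a & pdom q = `I_a].

Definition S1 (A : set nat) : set (nat -> option nat) :=
  [set (fun x => Some (h x)) | h in computable1] `|` Anf1 A.

Definition numbering T (X : set T) (nu : nat -> T) : Prop := range nu = X.

Definition quasi_Godel_numbering (pair : nat -> nat -> nat) (A : set nat)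
    (theta : nat -> nat -> option nat) : Prop :=
  [/\ numbering (S1 A) theta,
      exists2 f, computable1 f & range f = extended_graph2 pair theta
    & forall k, computable2 k ->
        exists2 v, computable1 v &
          forall i r, S1 A r ->
            range (k i) = extended_graph1 pair r -> r = theta (v i)].

Definition Godel_numbering (phi : nat -> nat -> option nat) : Prop :=
  [/\ numbering pcomputable1 phi,
      pcomputable2 phi
    & forall g, pcomputable2 g ->
        exists2 s, computable1 s & forall i x, phi (s i) x = g i x].

Definition computably_isomorphic T (mu nu : nat -> T) : Prop :=
  exists g : nat -> nat,
    [/\ computable1 g, bijective g & forall i, mu i = nu (g i)].

(* Main.v *)
(* Call a numbering U of c.e. sets acceptable if y \in U_i is c.e. in (i, y) and
   U has the s-m-n property for c.e. relations.  W is acceptable.  So is W^A: a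
   c.e. set is the range of the empty function or of a total computable
   function, hence each row of a c.e. relation has an extended graph enumerated
   uniformly by some k(i, _), to which (QGN II) applies.
   By the recursion theorem an acceptable numbering has padding: from i and n one
   computes an index of U_i larger than n.  Two acceptable numberings therefore
   reduce to each other by increasing computable functions, and for such
   functions the Schroeder-Bernstein construction is computable. *)

Require Import Defs.
From mathcomp Require Import all_boot.
From mathcomp Require Import boolp classical_sets functions cardinality.

Set Implicit Arguments.
Unset Strict Implicit.
Unset Printing Implicit Defensive.

(** * Closure properties of total computable functions *)

(* With nested pairs, the variables of an n-ary function of [p : ctx n] are the
   terms [p.1], [p.2.1], [p.2.2.1], ... *)
Fixpoint ctx n : Type := if n is n'.+1 then (nat * ctx n')%type else unit.

Fixpoint tuple_of_ctx n : ctx n -> n.-tuple nat :=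
  if n is n'.+1 then fun p => [tuple of p.1 :: tuple_of_ctx p.2]
  else fun=> [tuple].

(** [Comp] takes its inner functions as a family indexed by ordinals; this packs the values of such
    a family into a context. *)
Fixpoint ctx_of_fun n : ('I_n -> nat) -> ctx n :=
  if n is n'.+1 then fun h => (h ord0, ctx_of_fun (fun i => h (lift ord0 i)))
  else fun=> tt.

Lemma tnth_ctx0 n (p : ctx n.+1) : tnth (tuple_of_ctx p) ord0 = p.1.
Proof. exact: tnth0. Qed.

Lemma tnth_ctxS n (p : ctx n.+1) i :
  tnth (tuple_of_ctx p) (lift ord0 i) = tnth (tuple_of_ctx p.2) i.
Proof. exact: tnthS. Qed.

Lemma tnth_ctx_of_fun n (h : 'I_n -> nat) i :
  tnth (tuple_of_ctx (ctx_of_fun h)) i = h i.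
Proof.
elim: n h i => [|n IH] h i; first by case: i.
by case: (unliftP ord0 i) => [j ->|->]; rewrite ?tnth_ctxS ?IH ?tnth_ctx0.
Qed.

Lemma ctx_of_tnth n (p : ctx n) : ctx_of_fun (tnth (tuple_of_ctx p)) = p.
Proof.
elim: n p => [|n IH]; first by case.
case=> x p; congr (_, _); rewrite -[RHS]IH; congr ctx_of_fun.
by apply: funext => i; rewrite tnth_ctxS.
Qed.

Lemma tuple_of_ctxK n (v : n.-tuple nat) :
  tuple_of_ctx (ctx_of_fun (tnth v)) = v.
Proof. by apply: eq_from_tnth => i; rewrite tnth_ctx_of_fun. Qed.

Lemma behead_tuple_of_ctx n (p : ctx n.+1) :
  [tuple of behead (tuple_of_ctx p)] = tuple_of_ctx p.2.
Proof. exact: val_inj. Qed.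

Lemma thead_tuple_of_ctx n (p : ctx n.+1) : thead (tuple_of_ctx p) = p.1.
Proof. exact: tnth0. Qed.

(** Predicates are covered through the coercion of [bool] to [nat], so the same closure rules serve
    functions and decidable relations. *)
Definition computable n (h : ctx n -> nat) : Prop :=
  exists f : recfun n, forall p y, eval f (tuple_of_ctx p) y <-> h p = y.

Lemma eq_computable n (h h' : ctx n -> nat) :
  h =1 h' -> computable h -> computable h'.
Proof. by move=> e [f Hf]; exists f => p y; rewrite -e. Qed.

Lemma computable_comp n m (F : ctx m -> nat) (h : 'I_m -> ctx n -> nat) :
  computable F -> (forall i, computable (h i)) ->
  computable (fun p => F (ctx_of_fun (h^~ p))).
Proof.
move=> [f Hf] /choice [g Hg]; exists (Comp f g) => p y /=; split.
- case=> w Hw; have -> : w = tuple_of_ctx (ctx_of_fun (h^~ p)).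
    by apply: eq_from_tnth => i; rewrite tnth_ctx_of_fun; apply/esym/Hg.
  by move/Hf.
- move=> /Hf E; exists (tuple_of_ctx (ctx_of_fun (h^~ p))) => // i.
  by apply/Hg; rewrite tnth_ctx_of_fun.
Qed.

(** With recursion on [m], an explicit nested pair yields one goal per component. *)
Fixpoint computable_ctx n m : (ctx n -> ctx m) -> Prop :=
  if m is m'.+1 then fun s =>
    computable (fun p => (s p).1) /\ computable_ctx (fun p => (s p).2)
  else fun=> True.

Lemma computable_subst n m (F : ctx m -> nat) (s : ctx n -> ctx m) :
  computable F -> computable_ctx s -> computable (fun p => F (s p)).
Proof.
move=> HF Hs.
suff [h Hh sE] : exists2 h : 'I_m -> ctx n -> nat, forall i, computable (h i)
    & forall p, s p = ctx_of_fun (h^~ p).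
  by apply: eq_computable (computable_comp HF Hh) => p; rewrite sE.
elim: m s Hs {F HF} => [|m IH] s.
  by exists (fun _ _ => 0) => [[]//|p]; case: (s p).
case=> H1 /IH [h Hh E].
exists (fun i => if unlift ord0 i is Some j then h j else fun p => (s p).1).
  by move=> i; case: unliftP.
move=> p /=; rewrite unlift_none [LHS]surjective_pairing E; congr (_, _).
by congr ctx_of_fun; apply: funext => i; rewrite liftK.
Qed.

Lemma computable_var n i : computable (fun p : ctx n => tnth (tuple_of_ctx p) i).
Proof. by exists (Proj i) => p y /=; split => ->. Qed.

Lemma computable_fst n : computable (fun p : ctx n.+1 => p.1).
Proof. by apply: eq_computable (computable_var ord0) => p; rewrite tnth_ctx0. Qed.

Lemma computable_snd n (h : ctx n -> nat) :
  computable h -> computable (fun p : ctx n.+1 => h p.2).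
Proof.
move=> Hh; have := computable_comp Hh (fun i => computable_var (lift ord0 i)).
apply: eq_computable => p; congr h.
rewrite -[RHS]ctx_of_tnth; congr ctx_of_fun; apply: funext => i.
by rewrite tnth_ctxS.
Qed.

Lemma computable_ctx_snd n m (s : ctx n -> ctx m) :
  computable_ctx s -> computable_ctx (fun p : ctx n.+1 => s p.2).
Proof.
elim: m s => [//|m IH] s [H1 H2]; split; first exact: (computable_snd H1).
exact: (IH _ H2).
Qed.

Lemma computable_ctx_id n : computable_ctx (@id (ctx n)).
Proof.
elim: n => [//|n IH]; split; first exact: computable_fst.
exact: computable_ctx_snd IH.
Qed.

Lemma computable_ctx_of_fun n m (h : 'I_m -> ctx n -> nat) :
  (forall i, computable (h i)) -> computable_ctx (fun p => ctx_of_fun (h^~ p)).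
Proof. by elim: m h => [//|m IH] h Hh; split; [exact: Hh|apply: IH]. Qed.

Lemma computable_iteri n (K F : ctx n -> nat) (G : nat -> nat -> ctx n -> nat) :
  computable K -> computable F ->
  computable (fun q : ctx n.+2 => G q.1 q.2.1 q.2.2) ->
  computable (fun p => iteri (K p) (fun k z => G k z p) (F p)).
Proof.
move=> HK [f Hf] [g Hg].
(* [Prec] needs the counter as a separate first variable; [K p] is substituted for it afterwards. *)
pose H (q : ctx n.+1) := iteri q.1 (fun k z => G k z q.2) (F q.2).
suff HH : computable H.
  apply: (@computable_subst n n.+1 H (fun p => (K p, p)) HH); split => //.
  exact: computable_ctx_id.
exists (Prec f g) => -[k p] y /=.
rewrite (behead_tuple_of_ctx (k, p)) /H /= [thead _](thead_tuple_of_ctx (k, p)) /=.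
elim: k y => [|k IH] y /=; first exact: Hf.
have E z : [tuple of k :: z :: tuple_of_ctx p]
    = tuple_of_ctx ((k, (z, p)) : ctx n.+2) by apply: val_inj.
split.
- by case=> z /IH <-; rewrite E => /Hg.
- by move=> Ey; eexists; [apply/IH; reflexivity|rewrite E; apply/Hg].
Qed.

Lemma computable_S n (h : ctx n -> nat) :
  computable h -> computable (fun p => (h p).+1).
Proof.
move=> Hh; pose F (q : ctx 1) := q.1.+1.
suff HF : computable F by apply: (@computable_subst n 1 F (fun p => (h p, tt)) HF).
by exists Succ => p y; rewrite /= [thead _](thead_tuple_of_ctx p); split => [->|<-].
Qed.

Lemma computable_const n c : computable (fun _ : ctx n => c).
Proof.
elim: c => [|c IH]; last exact: computable_S IH.
by exists (Zero n) => p y /=; split => ->.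
Qed.

(** Recognises a variable of the context by stacking [computable_snd] on the fact [H]; [k] bounds
    the depth. *)
Ltac computable_proj H k :=
  first [ exact H
        | lazymatch k with
          | S ?k' => let H' := uconstr:(@computable_snd _ _ H) in
                     computable_proj H' k'
          end ].

Ltac computable_step :=
  first [ apply computable_const
        | assumption
        | computable_proj uconstr:(@computable_fst _) constr:(9) ].

Lemma computable_pred n (h : ctx n -> nat) :
  computable h -> computable (fun p => (h p).-1).
Proof.
move=> Hh; apply: (@eq_computable _ (fun p => iteri (h p) (fun k _ => k) 0)).
  by move=> p; case: (h p).
by apply: (computable_iteri (G := fun k _ _ => k)) => //; computable_step.
Qed.

Lemma computable_sub n (h h' : ctx n -> nat) :
  computable h -> computable h' -> computable (fun p => h p - h' p).
Proof.
move=> Hh Hh'.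
apply: (@eq_computable _ (fun p => iteri (h' p) (fun _ z => z.-1) (h p))).
  by move=> p; elim: (h' p) => [|k IH]; rewrite ?subn0 //= IH subnS.
apply: (computable_iteri (G := fun _ z _ => z.-1)) => //; apply: computable_pred.
computable_step.
Qed.

Lemma computable_if n (b : ctx n -> bool) (h h' : ctx n -> nat) :
  computable (fun p => b p : nat) -> computable h -> computable h' ->
  computable (fun p => if b p then h p else h' p).
Proof.
move=> Hb Hh Hh'.
(* The loop runs [b p] times, that is, once or not at all. *)
apply: (@eq_computable _ (fun p => iteri (b p) (fun _ _ => h p) (h' p))).
  by move=> p; case: (b p).
apply: (computable_iteri (G := fun _ _ => h)) => //.
exact: computable_snd (computable_snd Hh).
Qed.

Lemma computable_negb n (b : ctx n -> bool) :
  computable (fun p => b p : nat) -> computable (fun p => ~~ b p : nat).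
Proof.
move=> Hb; apply: (@eq_computable _ (fun p => if b p then 0 else 1)).
  by move=> p; case: (b p).
by apply: computable_if => //; computable_step.
Qed.

Lemma computable_andb n (b b' : ctx n -> bool) :
  computable (fun p => b p : nat) -> computable (fun p => b' p : nat) ->
  computable (fun p => b p && b' p : nat).
Proof.
move=> Hb Hb'.
apply: (@eq_computable _ (fun p => if b p then (b' p : nat) else 0)).
  by move=> p; case: (b p).
by apply: computable_if => //; computable_step.
Qed.

Lemma computable_ifb n (b c c' : ctx n -> bool) :
  computable (fun p => b p : nat) -> computable (fun p => c p : nat) ->
  computable (fun p => c' p : nat) ->
  computable (fun p => (if b p then c p else c' p) : nat).
Proof.
move=> Hb Hc Hc'.
apply: (@eq_computable _ (fun p => if b p then (c p : nat) else (c' p : nat))).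
  by move=> p; case: (b p).
exact: computable_if.
Qed.

Lemma computable_leq n (h h' : ctx n -> nat) :
  computable h -> computable h' -> computable (fun p => (h p <= h' p) : nat).
Proof.
move=> Hh Hh'.
apply: (@eq_computable _ (fun p => 1 - (h p - h' p))).
  by move=> p; rewrite /leq; case: (h p - h' p).
by do 2?[apply: computable_sub] => //; computable_step.
Qed.

Lemma computable_eq n (h h' : ctx n -> nat) :
  computable h -> computable h' -> computable (fun p => (h p == h' p) : nat).
Proof.
move=> Hh Hh'.
apply: (@eq_computable _ (fun p => (h p <= h' p) && (h' p <= h p) : nat)).
  by move=> p; rewrite -eqn_leq.
by apply: computable_andb; apply: computable_leq.
Qed.

(** * Bounded and unbounded search *)

Lemma computable_find n (K : ctx n -> nat) (b : nat -> ctx n -> bool) :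
  computable K -> computable (fun q : ctx n.+1 => b q.1 q.2 : nat) ->
  computable (fun p => find (b^~ p) (iota 0 (K p))).
Proof.
move=> HK Hb.
(* The accumulator equals [k] as long as nothing below [k] satisfies [b]. At the first success it
   stops growing, and from then on [k <= z] fails. *)
apply: (@eq_computable _ (fun p => iteri (K p)
   (fun k z => if (k <= z) && ~~ b k p then z.+1 else z) 0)).
  move=> p; elim: (K p) => [//|k IH].
  rewrite -[in RHS]addn1 iotaD find_cat /= IH add0n size_iota.
  rewrite has_find size_iota; have := find_size (b^~ p) (iota 0 k).
  rewrite size_iota leq_eqVlt => /predU1P[->|lt].
    by rewrite leqnn ltnn /=; case: (b k p); rewrite ?addn0 ?addn1.
  by rewrite lt leqNgt lt.
apply: (computable_iteri
  (G := fun k z p => if (k <= z) && ~~ b k p then z.+1 else z)) => //.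
  computable_step.
apply: computable_if; last by computable_step.
  apply: computable_andb; first by apply: computable_leq; computable_step.
  apply: computable_negb.
  apply: (@computable_subst n.+2 n.+1 (fun q => b q.1 q.2 : nat)
    (fun q => (q.1, q.2.2)) Hb); split.
    computable_step.
  exact: (computable_ctx_snd (computable_ctx_snd (computable_ctx_id n))).
by apply: computable_S; computable_step.
Qed.

Lemma computable_has n (K : ctx n -> nat) (b : nat -> ctx n -> bool) :
  computable K -> computable (fun q : ctx n.+1 => b q.1 q.2 : nat) ->
  computable (fun p => has (b^~ p) (iota 0 (K p)) : nat).
Proof.
move=> HK Hb.
apply: (@eq_computable _ (fun p => find (b^~ p) (iota 0 (K p)) < K p : nat)).
  by move=> p; rewrite has_find size_iota.
by apply: computable_leq => //; apply/computable_S/computable_find.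
Qed.

Lemma computable_all n (I : Type) (s : seq I) (b : I -> ctx n -> bool) :
  (forall i, computable (fun p => b i p : nat)) ->
  computable (fun p => all (b^~ p) s : nat).
Proof.
move=> Hb; elim: s => [|i s IH] /=; first by computable_step.
exact: computable_andb.
Qed.

(** [b] is negated because [Mu] looks for a zero. The result is a program rather than a total
    function, as the search may diverge. *)
Lemma computable_mu n (b : nat -> ctx n -> bool) :
  computable (fun q : ctx n.+1 => b q.1 q.2 : nat) ->
  exists f : recfun n, forall p y,
    eval f (tuple_of_ctx p) y <-> b y p /\ forall k, k < y -> ~~ b k p.
Proof.
case/computable_negb=> f Hf; exists (Mu f) => p y /=.
have E k z : eval f [tuple of k :: tuple_of_ctx p] z <-> ~~ b k p = z :> nat.
  exact: (Hf ((k, p) : ctx n.+1)).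
split=> [] [Hy H]; split.
- by move/E: Hy; case: (b y p).
- by move=> k /H [z /E]; case: (b k p).
- by apply/E; rewrite Hy.
- by move=> k /H Hk; exists 0; apply/E; rewrite Hk.
Qed.

(** The case [y = t] signals that the search below [t] has failed. *)
Lemma find_iota (a : pred nat) t y :
  find a (iota 0 t) = y <->
  [/\ y <= t, y < t -> a y & forall j, j < y -> ~~ a j].
Proof.
split=> [<-|[yt ay aj]].
  have le : find a (iota 0 t) <= t by rewrite -{2}(size_iota 0 t) find_size.
  split=> //.
    move=> lt; have : has a (iota 0 t) by rewrite has_find size_iota.
    by move=> /(nth_find 0); rewrite nth_iota.
  move=> j lt; have := before_find 0 lt.
  by rewrite nth_iota ?add0n ?(leq_trans lt) // => ->.
case: (ltngtP (find a (iota 0 t)) y) => // lt.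
- have := aj _ lt; have lt' := leq_trans lt yt.
  have : has a (iota 0 t) by rewrite has_find size_iota.
  by move=> /(nth_find 0); rewrite nth_iota // add0n => ->.
- have lt' : y < t.
    by apply: leq_trans lt _; rewrite -{2}(size_iota 0 t) find_size.
  by have := before_find 0 lt; rewrite nth_iota // add0n ay.
Qed.

(** * Evaluation in stages *)

(* [T t p] is y + 1 if f has been found by stage t to take the value y at p, and
   0 if no value has been found yet. *)
Definition stage_evaluation n (f : recfun n) (T : nat -> ctx n -> nat) : Prop :=
  [/\ computable (fun q : ctx n.+1 => T q.1 q.2),
      forall t t' p y, t <= t' -> T t p = y.+1 -> T t' p = y.+1
    & forall p y, eval f (tuple_of_ctx p) y <-> exists t, T t p = y.+1].

(** By monotonicity in the stage, finitely many computations can all be run up to one common stage,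
    the maximum of their own stages. *)
Lemma stage_evaluation_comp m n (f : recfun m) (g : 'I_m -> recfun n)
    (F : nat -> ctx m -> nat) (G : 'I_m -> nat -> ctx n -> nat) :
  stage_evaluation f F -> (forall i, stage_evaluation (g i) (G i)) ->
  stage_evaluation (Comp f g) (fun t p =>
    if all (fun i => 0 < G i t p) (enum 'I_m)
    then F t (ctx_of_fun (fun i => (G i t p).-1)) else 0).
Proof.
move=> [cF mF eF] sG.
have H0 i t p : (0 < G i t p) <-> exists z, G i t p = z.+1.
  by split=> [|[z ->]//]; case: (G i t p) => // z; exists z.
split.
- apply: computable_if; last by computable_step.
    apply: (@computable_all n.+1 _ _ (fun i q => 0 < G i q.1 q.2)) => i.
    by apply: computable_leq; first computable_step; case: (sG i).
  apply: (@computable_subst n.+1 m.+1 (fun q => F q.1 q.2)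
    (fun q => (q.1, ctx_of_fun (fun i => (G i q.1 q.2).-1)))) => //; split.
    by computable_step.
  apply: (@computable_ctx_of_fun n.+1 m (fun i q => (G i q.1 q.2).-1)) => i.
  by apply: computable_pred; case: (sG i).
- move=> t t' p y le; case: allP => // H Fy.
  have E i : exists2 z, G i t p = z.+1 & G i t' p = z.+1.
    have /H0 [z Ez] : 0 < G i t p by apply: H; rewrite mem_enum.
    by exists z => //; case: (sG i) => _ mG _; exact: mG Ez.
  have -> : all (fun i => 0 < G i t' p) (enum 'I_m).
    by apply/allP => i _; have [z _ ->] := E i.
  rewrite -(mF _ _ _ _ le Fy); congr F; congr ctx_of_fun; apply: funext => i.
  by have [z -> ->] := E i.
- move=> p y; split=> /=.
  + case=> w Hw; rewrite -(tuple_of_ctxK w) => /eF [s Es].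
    have /choice [u Hu] : forall i, exists t, G i t p = (tnth w i).+1.
      by move=> i; case: (sG i) => _ _ eG; apply/eG.
    pose t := maxn s (\max_i u i); exists t.
    have E i : G i t p = (tnth w i).+1.
      case: (sG i) => _ mG _; apply: mG (Hu i).
      by rewrite /t leq_max (leq_bigmax i) orbT.
    have -> : all (fun i => 0 < G i t p) (enum 'I_m).
      by apply/allP => i _; rewrite E.
    apply: (mF s); first by rewrite /t leq_maxl.
    by rewrite -Es; congr F; congr ctx_of_fun; apply: funext => i; rewrite E.
  + case=> t; case: allP => // H Fy.
    exists (tuple_of_ctx (ctx_of_fun (fun i => (G i t p).-1))); last first.
      by apply/eF; exists t.
    move=> i; rewrite tnth_ctx_of_fun; case: (sG i) => _ _ eG; apply/eG.
    by exists t; rewrite prednK //; apply: H; rewrite mem_enum.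
Qed.

(** The iteration works on shifted values: the code 0 of a value not yet found is passed on, and
    otherwise [z.-1] is the previous value. *)
Lemma stage_evaluation_prec n (f : recfun n) (g : recfun n.+2)
    (F : nat -> ctx n -> nat) (G : nat -> ctx n.+2 -> nat) :
  stage_evaluation f F -> stage_evaluation g G ->
  stage_evaluation (Prec f g) (fun t p =>
    iteri p.1 (fun k z => if 0 < z then G t (k, (z.-1, p.2)) else 0) (F t p.2)).
Proof.
move=> [cF mF eF] [cG mG eG].
have mono t t' k p y : t <= t' ->
    iteri k (fun k z => if 0 < z then G t (k, (z.-1, p)) else 0) (F t p) = y.+1 ->
    iteri k (fun k z => if 0 < z then G t' (k, (z.-1, p)) else 0) (F t' p) = y.+1.
  move=> le; elim: k y => [|k IH] y /=; first exact: mF.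
  case: (iteri k _ (F t p)) IH => // z IH /= Gy.
  by rewrite (IH z) //=; apply: mG Gy.
split.
- apply: (@computable_iteri n.+2 (fun q => q.2.1) (fun q => F q.1 q.2.2)
    (fun k z q => if 0 < z then G q.1 (k, (z.-1, q.2.2)) else 0)).
  + by computable_step.
  + apply: (@computable_subst n.+2 n.+1 (fun q => F q.1 q.2)
      (fun q => (q.1, q.2.2)) cF); split; first by computable_step.
    exact: (computable_ctx_snd (computable_ctx_snd (computable_ctx_id n))).
  + apply: computable_if; last by computable_step.
      by apply: computable_leq; computable_step.
    apply: (@computable_subst n.+4 n.+3 (fun q => G q.1 q.2)
      (fun q => (q.2.2.1, (q.1, (q.2.1.-1, q.2.2.2.2)))) cG).
    split; first by computable_step.
    split; first by computable_step.
    split; first by apply: computable_pred; computable_step.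
    exact: (computable_ctx_snd (computable_ctx_snd
      (computable_ctx_snd (computable_ctx_snd (computable_ctx_id n))))).
- by move=> t t' [k p] y; exact: mono.
- case=> k p y /=.
  rewrite (behead_tuple_of_ctx (k, p)) [thead _](thead_tuple_of_ctx (k, p)) /=.
  have E z j : [tuple of j :: z :: tuple_of_ctx p]
      = tuple_of_ctx ((j, (z, p)) : ctx n.+2) by apply: val_inj.
  elim: k y => [|k IH] y /=; first exact: eF.
  split.
  + case=> z /IH [t Ht]; rewrite E => /eG [s Es].
    exists (maxn t s); rewrite (mono _ _ _ _ _ (leq_maxl t s) Ht) /=.
    exact: mG (leq_maxr t s) Es.
  + case=> t; case Ez: (iteri k _ _) => [//|z] /= Gy.
    exists z; first by apply/IH; exists t.
    by rewrite E; apply/eG; exists t.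
Qed.

(** In shifted values 1 stands for the value 0, so the search stops at the first argument not yet
    known to have a positive value. It succeeds only if the value there is known to be 0. *)
Lemma stage_evaluation_mu n (f : recfun n.+1) (F : nat -> ctx n.+1 -> nat) :
  stage_evaluation f F ->
  stage_evaluation (Mu f) (fun t p =>
    let y := find (fun k => F t (k, p) <= 1) (iota 0 t) in
    if F t (y, p) == 1 then y.+1 else 0).
Proof.
move=> [cF mF eF].
have spec t p y : (let y := find (fun k => F t (k, p) <= 1) (iota 0 t) in
    if F t (y, p) == 1 then y.+1 else 0) = y.+1 <->
    [/\ y <= t, F t (y, p) = 1 & forall j, j < y -> 1 < F t (j, p)].
  split=> [/=|[yt Fy Fj]].
    case: eqP => // Fy [Ey]; rewrite Ey in Fy.
    by case/find_iota: Ey => yt _ Fj; split=> // j /Fj; rewrite -ltnNge.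
  have /= -> : find (fun k => F t (k, p) <= 1) (iota 0 t) = y.
    by apply/find_iota; split=> // [_|j /Fj]; rewrite ?Fy // -ltnNge.
  by rewrite Fy.
split.
- have cfind : computable (fun q : ctx n.+1 =>
      find (fun k => F q.1 (k, q.2) <= 1) (iota 0 q.1)).
    apply: (@computable_find n.+1 (fun q => q.1)
      (fun k q => F q.1 (k, q.2) <= 1)).
      by computable_step.
    apply: computable_leq; last by computable_step.
    apply: (@computable_subst n.+2 n.+2 (fun q => F q.1 q.2)
      (fun q => (q.2.1, (q.1, q.2.2))) cF).
    split; first by computable_step.
    split; first by computable_step.
    exact: (computable_ctx_snd (computable_ctx_snd (computable_ctx_id n))).
  apply: computable_if; last by computable_step.
    apply: computable_eq; last by computable_step.
    apply: (@computable_subst n.+1 n.+2 (fun q => F q.1 q.2)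
      (fun q => (q.1, (find (fun k => F q.1 (k, q.2) <= 1) (iota 0 q.1), q.2)))
      cF).
    split; first by computable_step.
    split; first exact: cfind.
    exact: computable_ctx_snd (computable_ctx_id n).
  exact: computable_S.
- move=> t t' p y le /spec [yt Fy Fj]; apply/spec.
  split; [exact: leq_trans le|exact: mF Fy|].
  move=> j /Fj; case Ej: (F t (j, p)) => [//|[//|z]] _.
  by rewrite (mF _ _ _ _ le Ej).
- move=> p y /=.
  have E k : [tuple of k :: tuple_of_ctx p]
      = tuple_of_ctx ((k, p) : ctx n.+1) by apply: val_inj.
  split.
  + case; rewrite E => /eF [s Es] H.
    have /choice [u Hu] : forall k : 'I_y, exists t, 1 < F t (nat_of_ord k, p).
      move=> k; case: (H k (ltn_ord k)) => z; rewrite E => /eF [t Et].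
      by exists t; rewrite Et.
    (* [y] enters the maximum because the search at stage [t] only extends up to [t]. *)
    pose t := maxn (maxn y s) (\max_k u k); exists t; apply/spec; split.
    * by rewrite /t !leq_max leqnn.
    * by apply: mF Es; rewrite /t !leq_max leqnn orbT.
    * move=> j jy; have := Hu (Ordinal jy).
      have le : u (Ordinal jy) <= t.
        by rewrite /t leq_max (leq_bigmax (Ordinal jy)) orbT.
      case Ej: (F _ _) => [//|[//|z]] _.
      by rewrite (mF _ _ _ _ le Ej).
  + case=> t /spec [yt Fy Fj]; split; first by rewrite E; apply/eF; exists t.
    move=> k /Fj; case Ek: (F _ _) => [//|[//|z]] _.
    by exists z; rewrite E; apply/eF; exists t.
Qed.

(** This takes the place of Kleene's normal form theorem: the graph of a program is the projection
    of a decidable relation. *)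
Lemma stage_evaluationP n (f : recfun n) : exists T, stage_evaluation f T.
Proof.
elim: f => {n} [n||n i|m n f [F sF] g /choice [G sG]
  |n f [F sF] g [G sG]|n f [F sF]].
- exists (fun _ _ => 1); split=> //; first by computable_step.
  by move=> p y; split=> [->|[_ []]//]; exists 0.
- exists (fun _ p => p.1.+2); split=> //.
    by do 2!apply: computable_S; computable_step.
  move=> p y /=; rewrite [thead _](thead_tuple_of_ctx p).
  by split=> [->|[_ []]//]; exists 0.
- exists (fun _ p => (tnth (tuple_of_ctx p) i).+1); split=> //.
    exact: computable_S (computable_snd (computable_var i)).
  by move=> p y; split=> [->|[_ []]//]; exists 0.
- by eexists; exact: stage_evaluation_comp sF sG.
- by eexists; exact: stage_evaluation_prec sF sG.
- by eexists; exact: stage_evaluation_mu sF.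
Qed.

(** * Functions of one, two and three arguments *)

Lemma computable1P h : computable1 h <-> computable (fun p : ctx 1 => h p.1).
Proof.
have E (x : nat) : [tuple x] = tuple_of_ctx ((x, tt) : ctx 1) by apply: val_inj.
split=> -[f Hf]; exists f.
  case=> x [] y; rewrite -E; apply: iff_trans (Hf x y) _.
  by split=> [[]|->].
move=> x y; rewrite E; apply: iff_trans (Hf (x, tt) y) _.
by split=> [->|[]].
Qed.

Lemma tuple_of_ctx2 (x x' : nat) :
  [tuple x; x'] = tuple_of_ctx ((x, (x', tt)) : ctx 2).
Proof. exact: val_inj. Qed.

Lemma computable2P h :
  computable2 h <-> computable (fun p : ctx 2 => h p.1 p.2.1).
Proof.
split=> -[f Hf]; exists f.
  case=> x [x' []] y; rewrite -tuple_of_ctx2.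
  by apply: iff_trans (Hf x x' y) _; split=> [[]|->].
move=> x x' y; rewrite tuple_of_ctx2.
by apply: iff_trans (Hf (x, (x', tt)) y) _; split=> [->|[]].
Qed.

Definition computable3 (h : nat -> nat -> nat -> nat) : Prop :=
  computable (fun p : ctx 3 => h p.1 p.2.1 p.2.2.1).

Lemma computable_app1 f n (h : ctx n -> nat) :
  computable1 f -> computable h -> computable (fun p => f (h p)).
Proof.
move=> /computable1P Hf Hh.
exact: (@computable_subst n 1 (fun q => f q.1) (fun p => (h p, tt)) Hf).
Qed.

Lemma computable_app2 f n (h h' : ctx n -> nat) :
  computable2 f -> computable h -> computable h' ->
  computable (fun p => f (h p) (h' p)).
Proof.
move=> /computable2P Hf Hh Hh'.
exact: (@computable_subst n 2 (fun q => f q.1 q.2.1)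
  (fun p => (h p, (h' p, tt))) Hf).
Qed.

Lemma computable_app3 f n (h h' h'' : ctx n -> nat) :
  computable3 f -> computable h -> computable h' -> computable h'' ->
  computable (fun p => f (h p) (h' p) (h'' p)).
Proof.
move=> Hf Hh Hh' Hh''.
exact: (@computable_subst n 3 (fun q => f q.1 q.2.1 q.2.2.1)
  (fun p => (h p, (h' p, (h'' p, tt)))) Hf).
Qed.

Lemma computable_app3b f n (h h' h'' : ctx n -> nat) :
  computable3 (fun x y z => f x y z : bool) ->
  computable h -> computable h' -> computable h'' ->
  computable (fun p => f (h p) (h' p) (h'' p) : nat).
Proof. exact: computable_app3. Qed.

Ltac computable_rule :=
  cbv beta;
  lazymatch goal with
  | |- computable (fun p => nat_of_bool (leq _ _)) => apply computable_leq
  | |- computable (fun p => nat_of_bool (eq_op _ _)) => apply computable_eq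
  | |- computable (fun p => nat_of_bool (andb _ _)) => apply computable_andb
  | |- computable (fun p => nat_of_bool (negb _)) => apply computable_negb
  | |- computable (fun p => nat_of_bool (has _ _)) => apply computable_has
  | |- computable (fun p => nat_of_bool (if _ then _ else _)) =>
      apply computable_ifb
  | |- computable (fun p => if _ then _ else _) => apply computable_if
  | |- computable (fun p => find _ _) => apply computable_find
  | |- computable (fun p => iteri _ _ _) => apply computable_iteri
  | |- computable (fun p => S _) =>
      first [ apply computable_const | apply computable_S ]
  | |- computable (fun p => predn _) => apply computable_pred
  | H : computable1 ?f |- computable (fun p => ?f _) =>
      apply (computable_app1 H)
  | H : computable2 ?f |- computable (fun p => ?f _ _) =>
      apply (computable_app2 H)
  | H : computable3 ?f |- computable (fun p => ?f _ _ _) =>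
      apply (computable_app3 H)
  | H : computable3 (fun x y z => nat_of_bool (?f x y z))
    |- computable (fun p => nat_of_bool (?f _ _ _)) =>
      apply (computable_app3b H)
  | |- _ => computable_step
  end.

Ltac computable_solve := repeat computable_rule.

(** A search that always succeeds defines a total function, namely the least witness. *)
Lemma computable_choice n (b : nat -> ctx n -> bool) :
  computable (fun q : ctx n.+1 => b q.1 q.2 : nat) ->
  (forall p, exists k, b k p) ->
  exists2 h : ctx n -> nat, computable h & forall p, b (h p) p.
Proof.
move=> /computable_mu [f Hf] H.
have Hy p : exists2 y, b y p & forall k, k < y -> ~~ b k p.
  case: (ex_minnP (H p)) => y by_ miny; exists y => // k ky.
  by apply/negP => /miny; rewrite leqNgt ky.
exists (fun p => ex_minn (H p)) => [|p]; last by case: ex_minnP.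
exists f => p y; rewrite Hf; case: ex_minnP => m bm minm; split.
  case=> bY ltY; apply/eqP; rewrite eqn_leq minm //= leqNgt.
  by apply/negP => /ltY /negP; apply.
by move=> <-; split=> // k; apply: contraTN => /minm; rewrite -leqNgt.
Qed.

(** * Inverting the pairing function *)

Definition unpairing (pair : nat -> nat -> nat) (a b : nat -> nat) : Prop :=
  [/\ computable1 a, computable1 b, forall x y, a (pair x y) = x
    & forall x y, b (pair x y) = y].

Lemma exists_unpairing pair :
  computable_pairing pair -> exists a b, unpairing pair a b.
Proof.
case=> cp [ab K1 K2] le.
have inj x y x' y' : pair x y = pair x' y' -> (x, y) = (x', y').
  by move=> E; apply: (can_inj K1); exact: E.
have Hpair z : pair (ab z).1 (ab z).2 = z := K2 z.
(* While x is being searched for, its partner y may be bounded by the given code, since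
   [y <= pair x y]; hence the test is decidable. *)
have [|p|h ch Hh] := @computable_choice 1
    (fun x p => has (fun y => pair x y == p.1) (iota 0 p.1.+1)).
- by computable_solve.
- exists (ab p.1).1; apply/hasP; exists (ab p.1).2; last by rewrite Hpair.
  rewrite mem_iota /= add0n ltnS -{2}(Hpair p.1).
  by case: (le (ab p.1).1 (ab p.1).2).
have [|p|h' ch' Hh'] := @computable_choice 1
    (fun y p => has (fun x => pair x y == p.1) (iota 0 p.1.+1)).
- by computable_solve.
- exists (ab p.1).2; apply/hasP; exists (ab p.1).1; last by rewrite Hpair.
  rewrite mem_iota /= add0n ltnS -{2}(Hpair p.1).
  by case: (le (ab p.1).1 (ab p.1).2).
have Ha x y : h (pair x y, tt) = x.
  by have /hasP[y' _ /eqP /inj [-> _]] := Hh (pair x y, tt).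
have Hb x y : h' (pair x y, tt) = y.
  by have /hasP[y' _ /eqP /inj [_ ->]] := Hh' (pair x y, tt).
exists (fun z => h (z, tt)), (fun z => h' (z, tt)); split=> //.
- by apply/computable1P; apply: eq_computable ch => -[z []].
- by apply/computable1P; apply: eq_computable ch' => -[z []].
Qed.

(** * Acceptable numberings of the c.e. sets *)

(** Here [t] is any kind of witness, for instance a stage paired with a preimage, so that
    existential quantifiers are absorbed by pairing. *)
Definition uniformly_ce (R : nat -> set nat) : Prop :=
  exists2 T : nat -> nat -> nat -> bool,
    computable3 (fun t i y => T t i y : nat) &
    forall i y, R i y <-> exists t, T t i y.

Definition acceptable (U : nat -> set nat) : Prop :=
  uniformly_ce U /\
  forall R, uniformly_ce R -> exists2 s, computable1 s & forall i, U (s i) = R i.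

Lemma pcomputable2_stages q : pcomputable2 q ->
  exists2 T, computable3 T & forall x x' y,
    q x x' = Some y <-> exists t, T t x x' = y.+1.
Proof.
case=> f Hf; have [T [cT _ eT]] := stage_evaluationP f.
exists (fun t x x' => T t (x, (x', tt))).
  by apply: eq_computable cT => -[t [x [x' []]]].
move=> x x' y; rewrite -(eT (x, (x', tt))) -tuple_of_ctx2.
exact: iff_sym (Hf x x' y).
Qed.

(** The partial function searches for the least witness [t], hence halts exactly on the elements of
    the set. *)
Lemma uniformly_ce_pdom R : uniformly_ce R ->
  exists2 q, pcomputable2 q & forall i, pdom (q i) = R i.
Proof.
case=> T cT RT.
have [|f Hf] := @computable_mu 2 (fun t p => T t p.1 p.2.1).
  by computable_solve.
pose q i y := if pselect (exists t, T t i y) is left H then Some (ex_minn H)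
  else None.
exists q.
  exists f => x x' y; rewrite tuple_of_ctx2 Hf /q /=; split.
    case=> Ty ltT; case: pselect => [H|[]]; last by exists y.
    case: ex_minnP => m Tm minm; congr Some; apply/eqP.
    rewrite eqn_leq minm //= leqNgt; apply/negP => /ltT /negP; exact.
  case: pselect => [H|//]; case: ex_minnP => m Tm minm [<-]; split=> // k.
  by apply: contraTN => /minm; rewrite -leqNgt.
move=> i; apply/seteqP; split=> y /=; rewrite /q.
  by case=> z; case: pselect => // H _; apply/RT.
by move=> /RT H; rewrite /pdom /=; case: pselect => // H'; eexists.
Qed.

Lemma acceptable_Godel phi :
  Godel_numbering phi -> acceptable (fun i => pdom (phi i)).
Proof.
case=> _ cphi smn; split.
  have [T cT TP] := pcomputable2_stages cphi.
  exists (fun t i y => 0 < T t i y); first by rewrite /computable3; computable_solve.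
  move=> i y; split.
    by case=> z /TP [t E]; exists t; rewrite E.
  by case=> t; case E: (T t i y) => [//|z] _; exists z; apply/TP; exists t.
move=> R /uniformly_ce_pdom [q /smn [s cs sE] qE]; exists s => // i.
by rewrite -qE; congr pdom; apply: funext => x.
Qed.

Lemma acceptable_quasi_Godel pair A theta :
  computable_pairing pair -> quasi_Godel_numbering pair A theta ->
  acceptable (fun i => prange (theta i)).
Proof.
move=> Hpair [_ [f cf fE] smn].
have [a [b [ca cb aE bE]]] := exists_unpairing Hpair.
have [cp _ _] := Hpair.
have inj x y x' y' : pair x y = pair x' y' -> x = x' /\ y = y'.
  by move=> E; rewrite -(aE x y) -{2}(bE x y) E aE bE.
have thetaE i x y :
    theta i x = Some y <-> exists t, f t = pair (pair i x) y.+1.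
  have -> : (exists t, f t = pair (pair i x) y.+1) <->
      (extended_graph2 pair theta) (pair (pair i x) y.+1).
    by rewrite -fE; split=> -[t]; [exists t|move=> _ <-; exists t].
  split=> [E|]; first by right; exists i, x, y.
  case=> [[y1 [y2 /inj []]]//|[x1 [x2 [y1 [E /inj []]]]]].
  by case/inj=> -> -> [->].
split.
  (* The witness [t] codes a position in the enumeration [f] together with a preimage of y under
     [theta i]. *)
  exists (fun t i y => f (a t) == pair (pair i (b t)) y.+1).
    by rewrite /computable3; computable_solve.
  move=> i y; split.
    by case=> x /thetaE [t E]; exists (pair t x); rewrite aE bE E.
  by case=> t /eqP E; exists (b t); apply/thetaE; exists (a t).
move=> R [T cT RT].
(* Here [t] codes an element with a witness for it. Values are shifted by one as in the extended
   graph, and 0 means that no element is produced. *)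
pose E i t := if T (b t) i (a t) then (a t).+1 else 0.
have RE i y : R i y <-> exists t, E i t = y.+1.
  split=> [/RT [t Tt]|[t]].
    by exists (pair y t); rewrite /E aE bE Tt.
  by rewrite /E; case: ifP => // Tt [<-]; apply/RT; exists (b t).
have cE : computable2 E by apply/computable2P; rewrite /E; computable_solve.
(* The function r to be enumerated takes at x the value E i x - 1 if E i x > 0,
   and otherwise E i s - 1 for the least s with E i s > 0; [E' i u] is 0 as long
   as the search for s below u fails, so that [u = 0] always contributes the
   point [pair x 0] of the extended graph. *)
pose E' i u := let s := find (fun s => 0 < E i s) (iota 0 u) in
  if s < u then E i s else 0.
have cE' : computable2 E' by apply/computable2P; rewrite /E'; computable_solve.
(* The guard [0 < b t] suppresses the direct value at u = 0, so that the point with second component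
   0 appears for every x. All nonzero second components at the same x agree. *)
pose k i t := pair (a t)
  (if (0 < b t) && (0 < E i (a t)) then E i (a t) else E' i (b t)).
have ck : computable2 k by apply/computable2P; rewrite /k; computable_solve.
have [v cv vE] := smn k ck; exists v => // i.
have kE x u : k i (pair x u) =
    pair x (if (0 < u) && (0 < E i x) then E i x else E' i u).
  by rewrite /k aE bE.
(* If [R i] is empty, then r is the nowhere defined function; otherwise r is total. *)
have [[s0 Es0]|none] := pselect (exists s, 0 < E i s); last first.
  have E0 s : E i s = 0.
    by apply/eqP; rewrite -leqn0 leqNgt; apply/negP => Es; apply: none; exists s.
  rewrite -(vE i (fun=> None)).
  - apply/seteqP; split=> y; first by case.
    by case/RE=> t; rewrite E0.
  - by right; left; apply/seteqP; split=> x //; case.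
  - apply/seteqP; split=> z.
      case=> t _ <-; left; exists (a t) => //; rewrite /k !E0 andbF /E' E0.
      by rewrite if_same.
    by case=> [[y _ <-]|[x [y [//]]]]; exists (pair y 0).
have [s Es smin] : exists2 s, 0 < E i s & forall j, j < s -> ~~ (0 < E i j).
  case: (ex_minnP (ex_intro (fun s => is_true (0 < E i s)) s0 Es0)) => m Em minm.
  by exists m => // j; apply: contraTN => /minm; rewrite -leqNgt.
have E'E u : E' i u = if s < u then E i s else 0.
  rewrite /E'; case: (ltnP s u) => su.
    have -> : find (fun s => 0 < E i s) (iota 0 u) = s.
      by apply/find_iota; split=> //; exact: ltnW.
    by rewrite su.
  have -> : find (fun s => 0 < E i s) (iota 0 u) = u.
    by apply/find_iota; split=> // [|j ju]; rewrite ?ltnn // smin // (leq_trans ju).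
  by rewrite ltnn.
(* [h] is r shifted by one; arguments that produce no element repeat the first element found. *)
pose h x := if 0 < E i x then E i x else E i s.
have h0 x : 0 < h x by rewrite /h; case: ifP.
have ch : computable1 (fun x => (h x).-1).
  by apply/computable1P; rewrite /h; computable_solve.
rewrite -(vE i (fun x => Some (h x).-1)).
- apply/seteqP; split=> y.
    case=> x [<-]; apply/RE; rewrite prednK // /h.
    by case: ifP => _; [exists x|exists s].
  by case/RE=> t Et; exists t; rewrite /h Et.
- by left; exists (fun x => (h x).-1).
- apply/seteqP; split=> z.
    case=> t _ <-; rewrite /k E'E.
    case: ifP => [/andP[_ Ex]|H].
      by right; exists (a t), (h (a t)).-1; rewrite prednK // /h Ex.
    case: ifP => sb; last by left; exists (a t).
    right; exists (a t), (h (a t)).-1; rewrite prednK // /h.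
    by move: H; rewrite (leq_trans _ sb) //= => ->.
  case=> [[x _ <-]|[x [_ [[<-] ->]]]]; first by exists (pair x 0).
  (* At u = s + 1 the search below u first reaches the success s. *)
  by exists (pair x s.+1) => //; rewrite kE E'E ltnSn prednK.
Qed.

(* Kleene's recursion theorem yields an index e of U_i if n < e, and of {j}
   otherwise.  Among the n + 2 choices j = 0, ..., n + 1 some must satisfy
   n < e, because distinct singletons have distinct indices. *)
Lemma acceptable_padding pair phi U :
  computable_pairing pair -> Godel_numbering phi -> acceptable U ->
  exists2 pad, computable2 pad & forall i n, n < pad i n /\ U (pad i n) = U i.
Proof.
move=> Hpair [phi1 cphi _] [[T cT UT] smn].
have [a [b [ca cb aE bE]]] := exists_unpairing Hpair.
have [cp _ _] := Hpair.
have [P cP phiP] := pcomputable2_stages cphi.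
(* The intended input is w = [pair m (pair i (pair n j))] with m an index of the function [s]
   obtained from [smn]. Then phi_m(w) = s(w), so [R w] refers to its own index. *)
pose in_ w := a (b w); pose nn w := a (b (b w)); pose jj w := b (b (b w)).
pose R w y := exists2 z, phi (a w) w = Some z &
  if nn w < z then U (in_ w) y else y = jj w.
have [|s cs sE] := smn R.
  exists (fun t w y => (0 < P (a t) (a w) w) &&
    (if nn w < (P (a t) (a w) w).-1 then T (b t) (in_ w) y else y == jj w)).
    by rewrite /computable3 /in_ /nn /jj; computable_solve.
  move=> w y; split.
    case=> z /phiP [t Pt]; case: ifP => lt.
      by case/UT=> u Tu; exists (pair t u); rewrite aE bE Pt /= lt.
    by move=> ->; exists (pair t 0); rewrite aE bE Pt /= lt eqxx.
  case=> t /andP[P0 H]; exists (P (a t) (a w) w).-1.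
    by apply/phiP; exists (a t); rewrite prednK.
  by move: H; case: ifP => _; [move=> Tt; apply/UT; exists (b t)|move/eqP].
(* This closes the circle: [s], being total computable, has an index that can be fed back to it. *)
have [m mE] : exists m, phi m = fun x => Some (s x).
  have : pcomputable1 (fun x => Some (s x)) by [].
  by rewrite -phi1 => -[m _ E]; exists m.
pose e i n j := s (pair m (pair i (pair n j))).
have eE i n j : U (e i n j) = if n < e i n j then U i else [set j]%classic.
  rewrite sE; apply/seteqP; split=> y; rewrite /R /in_ /nn /jj !(aE, bE) mE.
    by case=> z [<-]; rewrite -/(e i n j); case: ltnP.
  by move=> H; exists (e i n j) => //; move: H; case: ltnP.
have ce : computable3 e by rewrite /computable3 /e; computable_solve.
have [|p|h ch hE] := @computable_choice 2 (fun j p => p.2.1 < e p.1 p.2.1 j).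
- by computable_solve.
- case: p => i [n []] /=; have [//|none] := pselect (exists j, n < e i n j).
  have le j : e i n j < n.+1.
    by rewrite ltnS leqNgt; apply/negP => lt; apply: none; exists j.
  have inj : injective (fun j : 'I_n.+2 => Ordinal (le j)).
    move=> j j' [E]; have := eE i n j; rewrite E eE !ltnNge -ltnS le /=.
    by move=> /seteqP [/(_ _ erefl) /= H _]; apply: val_inj.
  by have := leq_card _ inj; rewrite !card_ord ltnn.
exists (fun i n => e i n (h (i, (n, tt)))).
  apply/computable2P; apply: (@computable_app3 e 2) => //.
  + by computable_step.
  + by computable_step.
  + by apply: eq_computable ch => -[i [n []]].
by move=> i n; have /= H := hE (i, (n, tt)); rewrite H eE H.
Qed.

(** * Increasing reductions and computable isomorphism *)

Lemma acceptable_reduction pair phi U V :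
  computable_pairing pair -> Godel_numbering phi ->
  acceptable U -> acceptable V ->
  exists f, [/\ computable1 f, injective f, forall x, x < f x
             & forall x, V (f x) = U x].
Proof.
move=> Hpair Hphi [cU _] HV.
have [pad cpad padP] := acceptable_padding Hpair Hphi HV.
have [_ /(_ _ cU) [t ct tE]] := HV.
(* The accumulator holds the value of [f] at the preceding argument, and padding beyond it makes [f]
   strictly increasing. With x + 1 rounds from 0, already [f 0 > 0], whence [x < f x]. *)
pose f x := iteri x.+1 (fun k z => pad (t k) z) 0.
have fS x : f x < f x.+1 by case: (padP (t x.+1) (f x)).
exists f; split.
- by apply/computable1P; rewrite /f; computable_solve.
- have mono : {homo f : x y / x < y}.
    by apply: homo_ltn => //; exact: ltn_trans.
  by move=> x y E; case: (ltngtP x y) => // /mono; rewrite E ltnn.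
- elim=> [|x IH]; last exact: leq_ltn_trans IH (fS x).
  by case: (padP (t 0) 0).
- by move=> x; rewrite -tE; case: (padP (t x) (iteri x (fun k z => pad (t k) z) 0)).
Qed.

(* Since [f] and [g] increase every argument, the chain leading to x is found
   among the numbers below x.  [C] collects the chains that start outside the
   range of [f]. *)
Lemma computable_Schroeder_Bernstein f g :
  computable1 f -> computable1 g -> injective f -> injective g ->
  (forall x, x < f x) -> (forall x, x < g x) ->
  exists2 h, computable1 h & bijective h /\ forall x, h x = f x \/ g (h x) = x.
Proof.
move=> cf cg injf injg ltf ltg.
pose gf k y := iteri k (fun _ z => g (f z)) (g y).
pose unhit y := ~~ has (fun z => f z == y) (iota 0 y).
(* Both searches may stop at x because [k + y < gf k y], shown in [gf_gt]. *)
pose C (x : nat) := has (fun k => has (fun y => unhit y && (gf k y == x)) (iota 0 x))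
  (iota 0 x).
have cC : computable (fun p : ctx 1 => C p.1 : nat).
  by rewrite /C /unhit /gf; computable_solve.
have unhitP y : reflect (forall z, f z <> y) (unhit y).
  apply: (iffP idP) => [/hasPn H z E|H].
    by have := H z; rewrite mem_iota /= add0n -{1}E ltf E eqxx => /(_ isT).
  by apply/hasPn => z _; apply/eqP/H.
have gf_gt k y : k + y < gf k y.
  elim: k => [|k IH]; first exact: ltg.
  by rewrite addSn; apply: leq_ltn_trans IH _; apply: ltn_trans (ltf _) (ltg _).
have CP x : reflect (exists k y, unhit y /\ gf k y = x) (C x).
  apply: (iffP hasP) => [[k _ /hasP[y _ /andP[uy /eqP E]]]|[k [y [uy E]]]].
    by exists k, y.
  have := gf_gt k y; rewrite E => lt; exists k.
    by rewrite mem_iota /= add0n (leq_ltn_trans _ lt) // leq_addr.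
  apply/hasP; exists y; last by rewrite uy E eqxx.
  by rewrite mem_iota /= add0n (leq_ltn_trans _ lt) // leq_addl.
have Cg y : unhit y -> C (g y) by move=> uy; apply/CP; exists 0, y.
have Cgf x : C (g (f x)) = C x.
  apply/CP/CP => -[k [y [uy E]]]; last by exists k.+1, y; rewrite -E.
  (* For k = 0, injectivity of [g] gives y = f x, against y being outside the range of [f];
     otherwise one round of g after f is cancelled. *)
  case: k E => [|k] /injg; last by move=> /injf E; exists k, y.
  by move=> E; move/unhitP: uy => /(_ x); rewrite E.
have Cran x : C x -> exists y, g y = x.
  by case/CP=> -[|k] [y [_ <-]]; [exists y|exists (f (gf k y))].
(* On [C] this is the inverse of [g], found below x since [g] increases its argument; elsewhere it
   is [f]. *)
pose h (x : nat) := if C x then find (fun y => g y == x) (iota 0 x) else f x.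
have hC x : C x -> g (h x) = x.
  move=> Cx; rewrite /h Cx; have [y gy] := Cran _ Cx.
  have Hh : has (fun y => g y == x) (iota 0 x).
    apply/hasP; exists y; last by rewrite gy eqxx.
    by rewrite mem_iota /= add0n -gy ltg.
  have /eqP := nth_find 0 Hh; rewrite nth_iota //.
  by rewrite has_find size_iota in Hh.
have hF x : ~~ C x -> h x = f x by rewrite /h => /negbTE ->.
exists h; first by apply/computable1P; apply: computable_if; [exact: cC|..];
  computable_solve.
split=> [|x]; last by case: (boolP (C x)) => [/hC|/hF]; [right|left].
have injh x y : h x = h y -> C x -> x = y.
  move=> E Cx; case: (boolP (C y)) => [/hC|nCy].
    by rewrite -E hC.
  (* If y is outside [C], then h y = f y, so g (f y) = g (h x) = x lies in [C], and by [Cgf] so does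
     y. *)
  by have := nCy; rewrite -Cgf -hF // -E hC // Cx.
have hinj : injective h.
  move=> x y E; case: (boolP (C x)) => [/(injh _ _ E) //|nCx].
  case: (boolP (C y)) => [/(injh _ _ (esym E)) //|nCy].
  by apply: injf; rewrite -!hF.
have hsurj y : exists x, h x = y.
  case: (boolP (C (g y))) => [/hC/injg E|nC]; first by exists (g y).
  (* If g y is outside [C], then y cannot start a chain and is some f x; by [Cgf], x is outside [C]
     too, so h x = f x. *)
  have [x fx] : exists x, f x = y.
    have : ~~ unhit y by apply: contra nC; exact: Cg.
    by rewrite negbK => /hasP[x _ /eqP]; exists x.
  by exists x; rewrite hF // -Cgf fx.
have [k hk] := choice hsurj.
by exists k => // x; apply: hinj; rewrite hk.
Qed.

Theorem theorem5p21 (pair : nat -> nat -> nat) (A : set nat)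
    (theta phi : nat -> nat -> option nat) :
  computable_pairing pair ->
  infinite_set A ->
  ce A ->
  quasi_Godel_numbering pair A theta ->
  Godel_numbering phi ->
  let WA := fun i => prange (theta i) in
  let W := fun i => pdom (phi i) in
  [/\ numbering ce WA, numbering ce W & computably_isomorphic WA W].
Proof.
move=> Hpair _ _ Htheta Hphi WA W.
have aWA : acceptable WA := acceptable_quasi_Godel Hpair Htheta.
have aW : acceptable W := acceptable_Godel Hphi.
have [f [cf injf ltf fE]] := acceptable_reduction Hpair Hphi aWA aW.
have [g [cg injg ltg gE]] := acceptable_reduction Hpair Hphi aW aWA.
have nW : numbering ce W.
  by case: Hphi => phi1 _ _; rewrite /numbering /ce -phi1 image_comp.
split=> //.
  (* The two reductions show that [WA] and [W] have the same range. *)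
  rewrite /numbering -nW; apply/seteqP; split=> _ [i _ <-].
    by exists (f i).
  by exists (g i).
have [h ch [bh hE]] := computable_Schroeder_Bernstein cf cg injf injg ltf ltg.
exists h; split=> // i.
(* In the second case W (h i) = WA (g (h i)) = WA i. *)
by case: (hE i) => [->|{1}<-]; [rewrite fE|rewrite gE].
Qed.
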